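(* Let $\mathbf{z}\in K_{\exp}^*$ with $z_x=z_y=0$ and $z_z>0$, so that $\{\mathbf{z}\}^\perp\cap K_{\exp}=\mathcal{F}_\infty$. Let $\eta>0$ and let $$\gamma_{\mathbf{z},\eta}:=\inf_{\mathbf{v}}\left\{\frac{\mathfrak{g}_\infty(\|\mathbf{w}-\mathbf{v}\|)}{\|\mathbf{w}-\mathbf{u}\|}\;\Big|\;\mathbf{v}\in\partial K_{\exp}\cap B(\eta)\setminus\mathcal{F}_\infty,\ \mathbf{w}=P_{\{\mathbf{z}\}^\perp}\mathbf{v},\ \mathbf{u}=P_{\mathcal{F}_\infty}\mathbf{w},\ \mathbf{w}\ne\mathbf{u}\right\}.$$ Then $\gamma_{\mathbf{z},\eta}\in(0,\infty]$ and $$\mathrm{d}(\mathbf{q},\mathcal{F}_\infty)\le\max\{2,2\gamma_{\mathbf{z},\eta}^{-1}\}\cdot\mathfrak{g}_\infty(\mathrm{d}(\mathbf{q},K_{\exp}))\quad\text{whenever } \mathbf{q}\in\{\mathbf{z}\}^\perp\cap B(\eta).$$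
   Context: $\mathbb{R}^3$ carries the standard inner product and Euclidean norm; vectors are written $\mathbf{p}=(p_x,p_y,p_z)$. $K_{\exp}=\{(x,y,z):y>0,\ z\ge ye^{x/y}\}\cup\{(x,y,z):x\le0,\ z\ge0,\ y=0\}$ is the exponential cone, $K_{\exp}^*$ its dual cone, $\partial K_{\exp}$ its boundary, and $\mathcal{F}_\infty=\{(x,0,0):x\le0\}$. $\mathfrak{g}_\infty:[0,\infty)\to[0,\infty)$ is given by $\mathfrak{g}_\infty(0)=0$, $\mathfrak{g}_\infty(t)=-1/\ln t$ for $0<t\le1/e^2$, and $\mathfrak{g}_\infty(t)=\frac14+\frac14e^2t$ for $t>1/e^2$. $B(\eta)$ is the closed ball of radius $\eta$ centered at the origin, $\mathrm{d}(\cdot,C)$ the distance to $C$, $P_C$ the orthogonal projection onto the closed convex set $C$. Conventions: infimum over the empty set is $+\infty$ and $1/\infty=0$. *)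

(* Defs.v *)
From HB Require Import structures.
From mathcomp Require Import all_boot all_order all_algebra.
From mathcomp Require Import all_classical all_reals all_analysis.

Set Implicit Arguments.
Unset Strict Implicit.
Unset Printing Implicit Defensive.

Import Order.TTheory GRing.Theory Num.Theory.
Import numFieldNormedType.Exports.

Local Open Scope classical_set_scope.
Local Open Scope ring_scope.

(* The library norm `|x| on row vectors is the sup norm, so the Euclidean norm
   and the notions derived from it are defined here.  The topology carried by
   'rV[R]_n is the same for both norms, so closure and interior are the
   library's. *)
Section Euclidean.
Variables (R : realType) (n : nat).
Implicit Types (u v x : 'rV[R]_n) (C : set 'rV[R]_n).

Definition dot u v : R := \sum_i u 0 i * v 0 i.

Definition enorm v : R := Num.sqrt (dot v v).

Definition eball (eta : R) : set 'rV[R]_n := [set v | enorm v <= eta].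

(* Meaningful for nonempty C only: inf set0 = 0 in R. *)
Definition dist_to C x : R := inf [set enorm (x - c) | c in C].

(* A nearest point of C to x, unique when C is nonempty, closed and convex;
   0 is the default value when there is no nearest point. *)
Definition eproj C x : 'rV[R]_n :=
  xget 0 [set p | C p /\ forall c, C c -> enorm (x - p) <= enorm (x - c)].

Definition perp v : set 'rV[R]_n := [set x | dot x v = 0].

Definition dual_cone C : set 'rV[R]_n :=
  [set v | forall x, C x -> 0 <= dot x v].

Definition boundary C : set 'rV[R]_n := closure C `\` interior C.

End Euclidean.

Section ExponentialCone.
Variable R : realType.
Implicit Types (v z : 'rV[R]_3).

Definition px v : R := v 0 0.
Definition py v : R := v 0 1.
Definition pz v : R := v 0 2.

Definition Kexp : set 'rV[R]_3 :=
  [set v | 0 < py v /\ py v * expR (px v / py v) <= pz v] `|`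
  [set v | [/\ px v <= 0, 0 <= pz v & py v = 0]].

Definition Finf : set 'rV[R]_3 :=
  [set v | [/\ px v <= 0, py v = 0 & pz v = 0]].

(* Only the values at t >= 0 are meaningful. *)
Definition ginf (t : R) : R :=
  if t == 0 then 0
  else if t <= expR 1 ^- 2 then - 1 / ln t
  else 1 / 4 + 1 / 4 * expR 1 ^+ 2 * t.

(* ereal_inf set0 = +oo. *)
Definition gamma z (eta : R) : \bar R :=
  ereal_inf [set r | exists v w u,
    [/\ ((boundary Kexp `&` eball eta) `\` Finf) v,
        w = eproj (perp z) v,
        u = eproj Finf w,
        w <> u &
        r = (ginf (enorm (w - v)) / enorm (w - u))%:E]].

End ExponentialCone.

Arguments Kexp {R}.
Arguments Finf {R}.

(* Main.v *)
(* Write v = (x, y, s) for a boundary point of Kexp with y > 0.  Its projection on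
   {z}^perp is w = (x, y, 0), so |w - v| = s = y e^(x/y), and u = (min(x, 0), 0, 0),
   so |w - u| <= max(x, 0) + y.  If x > 0 then s >= x + y and ginf s >= s; if
   -eta <= x <= 0 then -ln s <= (1 + eta) / y, or ginf s >= 1/4.  In every case
   gamma >= 1 / (4 (1 + eta)).
   For the error bound take q in {z}^perp and v in Kexp.  One may move v, without
   increasing |q - v|, so that |v| <= |q| and v is in Finf or on the graph
   s = y e^(x/y).  In the second case d(q, Finf) <= |q - w| + |w - u|, where
   |q - w| and |w - v| are at most |q - v| and |w - u| <= ginf |w - v| / gamma;
   now take the infimum over v. *)
Require Import Defs.
From HB Require Import structures.
From mathcomp Require Import all_boot all_order all_algebra.
From mathcomp Require Import all_classical all_reals all_analysis.
From mathcomp Require Import ring lra.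

Set Implicit Arguments.
Unset Strict Implicit.
Unset Printing Implicit Defensive.

Import Order.TTheory GRing.Theory Num.Theory.
Import numFieldNormedType.Exports.

Local Open Scope classical_set_scope.
Local Open Scope ring_scope.

(** * Inner product, Euclidean norm, nearest points and distance to a set *)

Section EuclideanGeometry.
Variables (R : realType) (n : nat).
Implicit Types (u v w x p c : 'rV[R]_n) (C : set 'rV[R]_n).

Lemma dotC u v : dot u v = dot v u.
Proof. by apply: eq_bigr => i _; rewrite mulrC. Qed.

Lemma dotDl u v w : dot (u + v) w = dot u w + dot v w.
Proof. by rewrite -big_split; apply: eq_bigr => i _; rewrite mxE mulrDl. Qed.

Lemma dotDr u v w : dot w (u + v) = dot w u + dot w v.
Proof. by rewrite dotC dotDl !(dotC w). Qed.

Lemma dotZl a u v : dot (a *: u) v = a * dot u v.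
Proof. by rewrite mulr_sumr; apply: eq_bigr => i _; rewrite mxE mulrA. Qed.

Lemma dotZr a u v : dot v (a *: u) = a * dot v u.
Proof. by rewrite dotC dotZl dotC. Qed.

Lemma dotNl u v : dot (- u) v = - dot u v.
Proof. by rewrite -scaleN1r dotZl mulN1r. Qed.

Lemma dotNr u v : dot v (- u) = - dot v u.
Proof. by rewrite dotC dotNl dotC. Qed.

Lemma dot0l v : dot 0 v = 0.
Proof. by rewrite -(scale0r v) dotZl mul0r. Qed.

Lemma dot0r v : dot v 0 = 0.
Proof. by rewrite dotC dot0l. Qed.

Definition dotE := (dotDl, dotDr, dotNl, dotNr, dotZl, dotZr).

Lemma dot_ge0 u : 0 <= dot u u.
Proof. by apply: sumr_ge0 => i _; rewrite -expr2 sqr_ge0. Qed.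

Lemma dot_eq0 u : dot u u = 0 -> u = 0.
Proof.
move=> u0; apply/rowP => i; rewrite mxE.
have /eqP : u 0 i * u 0 i = 0.
  by apply: (psumr_eq0P _ u0) => // j _; rewrite -expr2 sqr_ge0.
by rewrite mulf_eq0 orbb => /eqP.
Qed.

Lemma enorm_ge0 u : 0 <= enorm u.
Proof. exact: sqrtr_ge0. Qed.

Lemma enorm_sq u : enorm u ^+ 2 = dot u u.
Proof. by rewrite sqr_sqrtr ?dot_ge0. Qed.

Lemma ler_enorm u v : (enorm u <= enorm v) = (dot u u <= dot v v).
Proof. by rewrite ler_sqrt ?dot_ge0. Qed.

Lemma enorm_gt0 u : u <> 0 -> 0 < enorm u.
Proof.
move=> u0; rewrite lt0r enorm_ge0 andbT; apply/eqP => e0.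
by apply/u0/dot_eq0; rewrite -enorm_sq e0 expr0n.
Qed.

Lemma cauchy_schwarz u v : dot u v <= enorm u * enorm v.
Proof.
apply: le_trans (ler_norm _) _.
rewrite -ler_sqr ?nnegrE ?mulr_ge0 ?enorm_ge0// exprMn !enorm_sq real_normK ?num_real//.
have := dot_ge0 v; rewrite le_eqVlt => /predU1P[v0|v0].
  by rewrite (dot_eq0 (esym v0)) !dot0r mulr0 expr0n.
have := dot_ge0 (dot v v *: u - dot u v *: v).
rewrite !dotE (dotC v u) => h.
suff : 0 <= dot v v * (dot u u * dot v v - dot u v ^+ 2).
  by rewrite pmulr_rge0// subr_ge0.
by lra.
Qed.

Lemma enormD u v : enorm (u + v) <= enorm u + enorm v.
Proof.
rewrite -ler_sqr ?nnegrE ?addr_ge0 ?enorm_ge0// sqrrD !enorm_sq !dotE (dotC v u).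
by have := cauchy_schwarz u v; lra.
Qed.

(** Expanding |x - c|^2 about [p], the obtuse angle makes it at least |x - p|^2 + |c - p|^2. Hence
    [p] is the only nearest point, the value [xget] must return. *)
Lemma eproj_obtuse C x p : C p ->
  (forall c, C c -> dot (x - p) (c - p) <= 0) -> eproj C x = p.
Proof.
move=> Cp obt.
have pyth c : dot (x - c) (x - c) = dot (x - p) (x - p)
    - 2 * dot (x - p) (c - p) + dot (c - p) (c - p).
  have -> : x - c = (x - p) - (c - p) by rewrite opprB addrA subrK.
  by move: (x - p) (c - p) => a b; rewrite !dotE (dotC b); ring.
apply: xget_unique; first split=> // c Cc.
  by rewrite ler_enorm (pyth c); have := obt c Cc; have := dot_ge0 (c - p); lra.
move=> c [Cc /(_ _ Cp)]; rewrite ler_enorm (pyth c) => le_cp.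
apply/subr0_eq/dot_eq0/le_anti; rewrite dot_ge0 andbT.
by have := obt c Cc; lra.
Qed.

Lemma dist_to_le C x c : C c -> dist_to C x <= enorm (x - c).
Proof.
move=> Cc; apply: ge_inf; last by exists c.
by exists 0 => _ [d _ <-]; exact: enorm_ge0.
Qed.

Lemma le_dist_to C x a : C !=set0 ->
  (forall c, C c -> a <= enorm (x - c)) -> a <= dist_to C x.
Proof.
move=> [c0 Cc0] le_a; apply: lb_le_inf => [|_ [c Cc <-]]; last exact: le_a.
by exists (enorm (x - c0)), c0.
Qed.

End EuclideanGeometry.

(** * The function [ginf]: generalized inverse, monotonicity, comparison with the identity *)

Section Ginf.
Variable R : realType.
Implicit Types (a s t : R).
Local Notation e2 := (expR 1 ^- 2 : R).

(** Inverse of [ginf] on the positive reals: both branches of [ginf] equal 1/2 at [e2], which is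
    where the formula switches. *)
Definition ginf_adjoint a : R :=
  if a <= 1 / 2 then expR (- a^-1) else (4 * a - 1) * e2.

Lemma e2E : e2 = expR (- 2).
Proof. by rewrite -expRM_natl mulr1 -expRN. Qed.

Lemma ginf_gt0_le_e2 t : 0 < t -> t <= e2 -> ginf t = (- ln t)^-1.
Proof. by move=> t0 te; rewrite /ginf gt_eqF// te mulN1r invrN. Qed.

Lemma ln_le_e2 t : 0 < t -> t <= e2 -> 2 <= - ln t.
Proof.
move=> t0; rewrite e2E => te.
by rewrite lerNr -(expRK (- 2 : R)) ler_ln ?posrE ?expR_gt0.
Qed.

Lemma ginf_gt_e2 t : e2 < t -> ginf t = 1 / 4 + 1 / 4 * (t / e2).
Proof.
move=> te; have t0 : 0 < t by apply: lt_trans te; rewrite e2E expR_gt0.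
by rewrite /ginf gt_eqF// leNgt te/= invrK -mulrA (mulrC t).
Qed.

(* Replaces continuity of [ginf]: a bound [a <= ginf t] valid for all distances
   [t] passes to their infimum. *)
Lemma ginf_galois a t : 0 < a -> 0 <= t -> (a <= ginf t) = (ginf_adjoint a <= t).
Proof.
have e2_gt0 : 0 < e2 by rewrite e2E expR_gt0.
move=> a0; rewrite le_eqVlt => /predU1P[<-|t0].
  rewrite {1}/ginf eqxx leNgt a0; apply/esym/negbTE; rewrite -ltNge /ginf_adjoint.
  by case: ifPn => [_|]; rewrite ?expR_gt0// -ltNge => a2; apply: mulr_gt0 => //; lra.
rewrite /ginf_adjoint; have [te|te] := leP t e2.
  have lt2 := ln_le_e2 t0 te; have l0 : 0 < - ln t by lra.
  rewrite ginf_gt0_le_e2//; case: ifPn => [a2|].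
    by rewrite -{2}(lnK t0) ler_expR lerNl -[RHS]lef_pV2 ?posrE ?invr_gt0// invrK.
  (* Both sides fail: [ginf t <= 1 / 2 < a], while [ginf_adjoint a > e2 >= t]. *)
  rewrite -ltNge => a2; transitivity false.
    apply/negbTE; rewrite -ltNge; apply: le_lt_trans a2.
    by rewrite mul1r lef_pV2 ?posrE.
  apply/esym/negbTE; rewrite -ltNge; apply: le_lt_trans te _.
  by rewrite -{1}[e2]mul1r ltr_pM2r//; lra.
rewrite ginf_gt_e2//; case: ifPn => [a2|_].
  transitivity true.
    have : 1 < t / e2 by rewrite ltr_pdivlMr// mul1r.
    by lra.
  apply/esym/ltW/(le_lt_trans _ te); rewrite e2E ler_expR lerN2.
  by rewrite -[2]invrK lef_pV2 ?posrE ?invr_gt0//; lra.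
by rewrite -ler_pdivlMr//; apply/idP/idP; lra.
Qed.

Lemma ginf0 : ginf 0 = 0 :> R.
Proof. by rewrite /ginf eqxx. Qed.

Lemma ginf_ge0 t : 0 <= t -> 0 <= ginf t.
Proof.
rewrite le_eqVlt => /predU1P[<-|t0]; first by rewrite ginf0.
have [te|te] := leP t e2.
  by rewrite ginf_gt0_le_e2// invr_ge0; have := ln_le_e2 t0 te; lra.
rewrite ginf_gt_e2//; have : 0 < t / e2 by rewrite divr_gt0// e2E expR_gt0.
by lra.
Qed.

(** Comes from the adjunction, through [ginf_adjoint (ginf s) <= s <= t]. *)
Lemma ginf_le s t : 0 <= s -> s <= t -> ginf s <= ginf t.
Proof.
move=> s0 st; have := ginf_ge0 s0; rewrite le_eqVlt => /predU1P[<-|gs0].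
  exact/ginf_ge0/(le_trans s0).
rewrite ginf_galois// ?(le_trans s0)//; apply: le_trans st.
by rewrite -ginf_galois.
Qed.

Lemma ln_ge_invN t : 0 < t -> - ln t <= t^-1.
Proof. by move=> t0; rewrite -lnV ?posrE// ltW// ln_sublinear// invr_gt0. Qed.

(** The logarithmic branch uses -ln t <= 1/t; on the affine branch the slope e^2/4 is at least 1,
    since e >= 2. *)
Lemma le_ginf t : 0 <= t -> t <= ginf t.
Proof.
rewrite le_eqVlt => /predU1P[<-|t0]; first by rewrite ginf0.
have [te|te] := leP t e2.
  rewrite ginf_gt0_le_e2//; have := ln_le_e2 t0 te => l2.
  by rewrite -[leLHS]invrK lef_pV2 ?posrE ?invr_gt0 ?ln_ge_invN//; lra.
rewrite ginf_gt_e2// invrK.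
have e_ge2 : 2 <= expR 1 :> R by have := expR_ge1Dx (1 : R); lra.
have : 2 ^+ 2 <= expR 1 ^+ 2 :> R by rewrite lerXn2r ?nnegrE ?expR_ge0.
by nra.
Qed.

End Ginf.

(** * Sliding a point along its ray *)

Section NearestPointOnRay.
Variables (R : realType) (n : nat).
Implicit Types q v : 'rV[R]_n.

(** Take the point of the ray through [v] nearest to [q]: the origin if [dot q v <= 0], else the
    orthogonal projection of [q], no longer than [q] by Cauchy-Schwarz. *)
Lemma ray_approx q v : exists t : R,
  [/\ 0 <= t, enorm (t *: v) <= enorm q & enorm (q - t *: v) <= enorm (q - v)].
Proof.
have [qv|qv] := leP (dot q v) 0.
  exists 0; rewrite scale0r subr0 !ler_enorm !dotE dot0l dot_ge0 (dotC v q).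
  by split=> //; have := dot_ge0 v; lra.
have v_gt0 : 0 < dot v v.
  rewrite lt0r dot_ge0 andbT; apply/eqP => /dot_eq0 v0.
  by move: qv; rewrite v0 dot0r ltxx.
have CS : dot q v ^+ 2 <= dot q q * dot v v.
  rewrite -!enorm_sq -exprMn ler_sqr ?nnegrE ?cauchy_schwarz ?(ltW qv)//.
  by rewrite mulr_ge0 ?enorm_ge0.
exists (dot q v / dot v v); split; first by rewrite divr_ge0 ?ltW.
  rewrite ler_enorm !dotE mulfVK ?gt_eqF// mulrAC -expr2.
  by rewrite ler_pdivrMr.
rewrite ler_enorm !dotE (dotC v q) mulfVK ?gt_eqF//.
(* This quotient is exactly |q - v|^2 - |q - t v|^2. *)
have : 0 <= (dot v v - dot q v) ^+ 2 / dot v v by rewrite divr_ge0 ?sqr_ge0 ?ltW.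
rewrite (_ : _ / _ = dot v v - 2 * dot q v + dot q v / dot v v * dot q v).
  by lra.
by field; rewrite gt_eqF.
Qed.

End NearestPointOnRay.

(** * Coordinates in three-space and the projections onto [perp z] and [Finf] *)

Section Space.
Variable R : realType.
Implicit Types (x y s t : R) (u v w q z : 'rV[R]_3).

Definition vec3 x y s : 'rV[R]_3 := \row_i nth 0 [:: x; y; s] i.

Lemma px_vec3 x y s : px (vec3 x y s) = x. Proof. by rewrite /px mxE. Qed.
Lemma py_vec3 x y s : py (vec3 x y s) = y. Proof. by rewrite /py mxE. Qed.
Lemma pz_vec3 x y s : pz (vec3 x y s) = s. Proof. by rewrite /pz mxE. Qed.

Lemma pxB u v : px (u - v) = px u - px v. Proof. by rewrite /px !mxE. Qed.
Lemma pyB u v : py (u - v) = py u - py v. Proof. by rewrite /py !mxE. Qed.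
Lemma pzB u v : pz (u - v) = pz u - pz v. Proof. by rewrite /pz !mxE. Qed.

Lemma pxZ t v : px (t *: v) = t * px v. Proof. by rewrite /px !mxE. Qed.
Lemma pyZ t v : py (t *: v) = t * py v. Proof. by rewrite /py !mxE. Qed.
Lemma pzZ t v : pz (t *: v) = t * pz v. Proof. by rewrite /pz !mxE. Qed.

Definition coordE := (px_vec3, py_vec3, pz_vec3, pxB, pyB, pzB, pxZ, pyZ, pzZ).

Lemma ord3_ind (P : 'I_3 -> Prop) : P 0 -> P 1 -> P 2 -> forall i, P i.
Proof.
move=> P0 P1 P2 [[|[|[|//]]] lt_i3].
- by rewrite (_ : Ordinal _ = 0)//; exact: val_inj.
- by rewrite (_ : Ordinal _ = 1)//; exact: val_inj.
- by rewrite (_ : Ordinal _ = 2)//; exact: val_inj.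
Qed.

Lemma vec3P u v : px u = px v -> py u = py v -> pz u = pz v -> u = v.
Proof. by move=> ux uy uz; apply/rowP; exact: ord3_ind. Qed.

Lemma dot3 u v : dot u v = px u * px v + py u * py v + pz u * pz v.
Proof.
rewrite /dot !big_ord_recl big_ord0 addr0 addrA.
have -> : lift ord0 (lift ord0 ord0) = 2 :> 'I_3 by exact: val_inj.
by have -> : lift ord0 ord0 = 1 :> 'I_3 by exact: val_inj.
Qed.

Lemma enorm_le_add v : 0 <= px v -> 0 <= py v -> pz v = 0 -> enorm v <= px v + py v.
Proof.
move=> x0 y0 s0; rewrite -ler_sqr ?nnegrE ?addr_ge0 ?enorm_ge0//.
by rewrite enorm_sq dot3 s0; nra.
Qed.

Lemma abs_px_le v : `|px v| <= enorm v.
Proof.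
rewrite -sqrtr_sqr ler_sqrt ?dot_ge0// dot3 -!expr2.
by rewrite -addrA lerDl addr_ge0 ?sqr_ge0.
Qed.

Lemma abs_py_le v : `|py v| <= enorm v.
Proof.
rewrite -sqrtr_sqr ler_sqrt ?dot_ge0// dot3 -!expr2.
by rewrite addrAC lerDr addr_ge0 ?sqr_ge0.
Qed.

Lemma perpE z v : px z = 0 -> py z = 0 -> 0 < pz z -> perp z v <-> pz v = 0.
Proof.
move=> zx zy zz; rewrite /perp/= dot3 zx zy !mulr0 !add0r.
split=> [/eqP|->]; last by rewrite mul0r.
by rewrite mulf_eq0 (gt_eqF zz) orbF => /eqP.
Qed.

Lemma eproj_perp z v : px z = 0 -> py z = 0 -> 0 < pz z ->
  eproj (perp z) v = vec3 (px v) (py v) 0.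
Proof.
move=> zx zy zz; apply: eproj_obtuse => [|c]; rewrite perpE// ?coordE//.
by move=> c0; rewrite dot3 !coordE c0; lra.
Qed.

Lemma eproj_Finf v : eproj Finf v = vec3 (Num.min (px v) 0) 0 0.
Proof.
apply: eproj_obtuse => [|c [cx cy cz]].
  by split; rewrite !coordE// ge_min lexx orbT.
rewrite dot3 !coordE cy cz !subr0 !mulr0 !addr0.
by have [x0|x0] := leP (px v) 0; [rewrite subrr mul0r|rewrite !subr0; nra].
Qed.

End Space.

(** * The exponential cone: closedness, boundary graph, and the estimate behind [gamma] *)

Section ExpCone.
Variable R : realType.
Implicit Types (x y s t r eta : R) (u v w q z : 'rV[R]_3).

(* [y * exp (x / y)] lies above its tangent planes along [x = r * y].  These
   closed half-spaces, with [y >= 0] and [z >= 0], cut out [Kexp]. *)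
Lemma Kexp_tangent v r : Kexp v -> expR r * (py v * (1 - r) + px v) <= pz v.
Proof.
move=> [[y0 le_z]|[x0 z0 y0]]; last first.
  by rewrite y0; have := expR_ge0 r; nra.
(* Write x/y = h + r and use 1 + h <= e^h. *)
apply: le_trans le_z; rewrite -(subrK r (_ / _)) expRD mulrA mulrC.
rewrite ler_pM2r ?expR_gt0//.
have : py v * (1 + (px v / py v - r)) <= py v * expR (px v / py v - r).
  by rewrite ler_pM2l// expR_ge1Dx.
rewrite !mulrDr mulrN (mulrC _ (_ / _)) divfK ?gt_eqF//.
by lra.
Qed.

Lemma Kexp_py_ge0 v : Kexp v -> 0 <= py v.
Proof. by move=> [[/ltW]|[_ _ ->]]. Qed.

Lemma Kexp_pz_ge0 v : Kexp v -> 0 <= pz v.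
Proof.
move=> [[y0 le_z]|[//]]; apply: le_trans le_z.
by rewrite mulr_ge0 ?expR_ge0 ?ltW.
Qed.

Lemma closure_ge0 (T : topologicalType) (A : set T) (f : T -> R) a :
  continuous f -> (forall b, A b -> 0 <= f b) -> closure A a -> 0 <= f a.
Proof.
move=> cf fA; have clP : closed [set b | 0 <= f b].
  by apply: (@preimage_closed _ _ f [set y | 0 <= y]) => [? _|]; [exact: cf|exact: closed_ge].
by move/(closure_subset (fA : A `<=` [set b | 0 <= f b])); rewrite -(closure_id _).1.
Qed.

(** The non-strict tangent inequalities survive in the closure, and the choice r = x/y recovers the
    exponential one when y > 0. *)
Lemma closed_Kexp v : closure Kexp v -> Kexp v.
Proof.
move=> clv.
have cx : continuous (@px R) by move=> ?; exact: coord_continuous.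
have cy : continuous (@py R) by move=> ?; exact: coord_continuous.
have cz : continuous (@pz R) by move=> ?; exact: coord_continuous.
have y0 := closure_ge0 cy Kexp_py_ge0 clv.
have z0 := closure_ge0 cz Kexp_pz_ge0 clv.
have tangent r : expR r * (py v * (1 - r) + px v) <= pz v.
  rewrite -subr_ge0.
  apply: (@closure_ge0 _ Kexp (fun u => pz u - expR r * (py u * (1 - r) + px u))) clv.
    move=> u; apply: continuousB; first exact: cz.
    apply: continuousM; first exact: cst_continuous.
    apply: continuousD; last exact: cx.
    by apply: continuousM; [exact: cy|exact: cst_continuous].
  by move=> u /Kexp_tangent; rewrite subr_ge0.
move: y0; rewrite le_eqVlt => /predU1P[y0|y0]; [right|left].
  split=> //; rewrite leNgt; apply/negP => x0.
  (* If y = 0 < x, the slope r = z/x gives e^r x <= z, against e^r x >= (1 + r) x = x + z. *)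
  have := tangent (pz v / px v); rewrite -y0 mul0r add0r leNgt => /negP; apply.
  have := expR_ge1Dx (pz v / px v); rewrite -(ler_pM2r x0) mulrDl divfK ?gt_eqF//.
  by lra.
split=> //; apply: le_trans (tangent (px v / py v)).
by rewrite mulrBr mulr1 mulrCA divff ?gt_eqF// mulr1 subrK mulrC.
Qed.

Definition exp_graph v := 0 < py v /\ pz v = py v * expR (px v / py v).

Lemma exp_graph_Kexp v : exp_graph v -> Kexp v.
Proof. by move=> [y0 zE]; left; rewrite /= zE. Qed.

Lemma exp_graphZ t v : 0 < t -> exp_graph v -> exp_graph (t *: v).
Proof.
move=> t0 [y0 zE]; split; rewrite !coordE ?mulr_gt0//.
by rewrite -mulf_div divff ?gt_eqF// mul1r zE mulrA.
Qed.

Lemma exp_graph_boundary v : exp_graph v -> boundary Kexp v.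
Proof.
move=> gv; split; first exact/subset_closure/exp_graph_Kexp.
case: gv => y0 zE /nbhs_ballP[e /= e0].
(* The point [e / 2] below [v] lies in the sup-norm ball but beneath the graph, hence outside
   [Kexp]. *)
move=> /(_ (vec3 (px v) (py v) (pz v - e / 2))); rewrite /Kexp/= !coordE => ball_sub.
have [|[_]|[_ _ yE]] := ball_sub; last by rewrite yE ltxx in y0.
- by split=> // i; rewrite ord1; elim/ord3_ind; rewrite mxE/=
    /ball/= ?subrr ?normr0// opprB addrC subrK gtr0_norm; lra.
- by rewrite -zE; lra.
Qed.

(* Near-minimizers suffice, so no projection onto [Kexp] is needed: lowering a
   point of [Kexp] to the graph brings it closer to [q], and sliding it along its
   ray then puts it in the ball of radius [enorm q] without moving it away. *)
Lemma Kexp_near_perp q v : pz q = 0 -> Kexp v -> exists v',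
  [/\ Finf v' \/ exp_graph v', enorm v' <= enorm q &
      enorm (q - v') <= enorm (q - v)].
Proof.
move=> qz Kv.
have [v1 Fv1 le_qv1] : exists2 v1,
    Finf v1 \/ exp_graph v1 & enorm (q - v1) <= enorm (q - v).
  case: Kv => [[y0 le_z]|[x0 z0 y0]].
    exists (vec3 (px v) (py v) (py v * expR (px v / py v))).
      by right; rewrite /exp_graph !coordE.
    have := mulr_gt0 y0 (expR_gt0 (px v / py v)).
    by rewrite ler_enorm !dot3 !coordE qz; nra.
  exists (vec3 (px v) 0 0); first by left; split; rewrite !coordE.
  by rewrite ler_enorm !dot3 !coordE qz y0; nra.
have [t [t0 le_tq le_qt]] := ray_approx q v1.
exists (t *: v1); split=> //; last exact: le_trans le_qv1.
move: t0; rewrite le_eqVlt => /predU1P[<-|t0].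
  by left; split; rewrite !coordE mul0r.
case: Fv1 => [[x0 y0 z0]|gv]; last by right; exact: exp_graphZ.
by left; split; rewrite !coordE ?y0 ?z0 ?mulr0// pmulr_rle0.
Qed.

(** For a boundary point of height [s], the left side bounds |w - u| and [s] is |w - v|, so each
    quotient in [gamma] is at least 1 / (4 (1 + eta)). The factor 4 offsets the constant 1/4 of the
    affine branch. *)
Lemma ginf_exp_ge eta x y s : 0 < y -> y <= eta -> - eta <= x ->
  y * expR (x / y) <= s -> Num.max x 0 + y <= 4 * (1 + eta) * ginf s.
Proof.
move=> y0 y_eta x_eta le_s.
have p0 : 0 < y * expR (x / y) by rewrite mulr_gt0 ?expR_gt0.
have gs0 := ginf_ge0 (ltW (lt_le_trans p0 le_s)).
have [x0|x0] := leP x 0; last first.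
  apply: (@le_trans _ _ (ginf s)); last by nra.
  apply: le_trans (le_ginf (ltW (lt_le_trans p0 le_s))).
  apply: le_trans le_s.
  have : y * (1 + x / y) <= y * expR (x / y) by rewrite ler_pM2l// expR_ge1Dx.
  by rewrite mulrDr mulr1 mulrC divfK ?gt_eqF// addrC.
have le_g := ginf_le (ltW p0) le_s.
rewrite add0r; apply: (@le_trans _ _ (4 * (1 + eta) * ginf (y * expR (x / y)))); last by nra.
have [le_e|lt_e] := leP (y * expR (x / y)) (expR 1 ^- 2).
  have l2 := ln_le_e2 p0 le_e; have l0 : 0 < - ln (y * expR (x / y)) by lra.
  rewrite ginf_gt0_le_e2// ler_pdivlMr//.
  (* y (-ln (y e^(x/y))) = y (-ln y) - x <= 1 + eta. *)
  rewrite lnM ?posrE ?expR_gt0// expRK.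
  have ly : y * - ln y <= 1 by rewrite -(divff (lt0r_neq0 y0)) ler_pM2l// ln_ge_invN.
  by rewrite opprD mulrDr (mulrN y (x / y)) (mulrC y (x / y)) divfK ?gt_eqF//; lra.
rewrite ginf_gt_e2//.
have : 0 < y * expR (x / y) / expR 1 ^- 2 by rewrite divr_gt0// e2E expR_gt0.
by nra.
Qed.

End ExpCone.

(* In \bar R, +oo^-1 = 0. *)
Theorem theorem4p10 (R : realType) (z : 'rV[R]_3) (eta : R)
    (hz : dual_cone Kexp z) (hzx : px z = 0) (hzy : py z = 0) (hzz : 0 < pz z)
    (heta : 0 < eta) :
  [/\ perp z `&` Kexp = Finf,
      (0 < gamma z eta)%E &
      forall q : 'rV[R]_3, (perp z `&` eball eta) q ->
        ((dist_to Finf q)%:E <=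
          maxe 2%:E (2%:E * (gamma z eta)^-1) * (ginf (dist_to Kexp q))%:E)%E].
Proof.
have perpP v : perp z v <-> pz v = 0 by exact: perpE.
have gamma_gt0 : (0 < gamma z eta)%E.
  apply: (@lt_le_trans _ _ (4 * (1 + eta))^-1%:E).
    by rewrite lte_fin invr_gt0; lra.
  apply: le_ereal_inf_tmp => _ [v [w [u [[[[clv _] bv] _] -> -> + ->]]]].
  rewrite eproj_Finf eproj_perp// !coordE => neq.
  have Kv := closed_Kexp clv.
  have dwu : 0 < enorm (vec3 (px v) (py v) 0 - vec3 (Num.min (px v) 0) 0 0).
    by apply: enorm_gt0 => /subr0_eq.
  rewrite lee_fin ler_pdivlMr// ler_pdivrMl; last by lra.
  (* Over y = 0 the point w already lies in [Finf], so w = u, which is excluded. *)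
  have [y0 le_z] : 0 < py v /\ py v * expR (px v / py v) <= pz v.
    case: Kv => // -[x0 _ y0]; case: neq.
    by apply: vec3P; rewrite !coordE// min_l.
  have -> : vec3 (px v) (py v) 0 - v = - pz v *: vec3 0 0 1.
    by apply: vec3P; rewrite !coordE; lra.
  have -> : enorm (- pz v *: vec3 0 0 1) = pz v.
    rewrite /enorm dot3 !coordE !mulr0 !add0r !mulr1 mulrNN -expr2 sqrtr_sqr.
    by rewrite ger0_norm// Kexp_pz_ge0.
  have := le_trans (abs_px_le v) bv; rewrite ler_norml => /andP[x_eta _].
  have := le_trans (abs_py_le v) bv; rewrite ler_norml => /andP[_ y_eta].
  apply: le_trans (ginf_exp_ge y0 y_eta x_eta le_z).
  apply: le_trans (enorm_le_add _ _ _) _; rewrite ?coordE ?subr0 ?(ltW y0)//.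
    by rewrite subr_ge0 ge_min lexx.
  by rewrite lerD2r; have [x0|x0] := leP (px v) 0; rewrite ?subr0 ?subrr.
split=> //.
  apply/seteqP; split=> v.
    case=> /perpP z0 [[y0]|[x0 _ y0] //].
    by rewrite z0 leNgt mulr_gt0 ?expR_gt0.
  by move=> [x0 y0 z0]; split; [exact/perpP|right; rewrite /= z0].
move=> q [/perpP qz bq].
(* [m] is the real value of the maximum. The last property is how the infimum enters the estimate;
   it is vacuous when [gamma] is infinite, where [m = 2]. *)
have [m [m2 -> mP]] : exists m : R,
    [/\ 2 <= m, (maxe 2%:E (2%:E * (gamma z eta)^-1) = m%:E)%E &
        forall r : R, (gamma z eta <= r%:E)%E -> 2 <= m * r].
  case: (gamma z eta) gamma_gt0 => [g| |]//.
    rewrite lte_fin => g0; exists (Num.max 2 (2 / g)); split.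
    - by rewrite le_max lexx.
    - by rewrite inver gt_eqF// -EFinM EFin_max.
    - move=> r; rewrite lee_fin => le_gr; rewrite -ler_pdivrMr ?(lt_le_trans g0)//.
      by rewrite le_max ler_pM2l// lef_pV2 ?posrE ?(lt_le_trans g0)// le_gr orbT.
  move=> _; exists 2; split=> //.
  by rewrite invey mule0 maxEle lee_fin leNgt ltr0n.
have K0 : Kexp (0 : 'rV[R]_3) by right; split; rewrite ?/px ?/py ?/pz ?mxE.
have dK0 : 0 <= dist_to Kexp q.
  by apply: le_dist_to => [|c _]; [exists 0|exact: enorm_ge0].
rewrite -EFinM lee_fin.
have approx v : Kexp v -> dist_to Finf q <= m * ginf (enorm (q - v)).
  move=> /(Kexp_near_perp qz)[v' [Fv' le_v'q le_qv']].
  apply: (@le_trans _ _ (m * ginf (enorm (q - v')))); last first.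
    by rewrite ler_pM2l ?ginf_le ?enorm_ge0//; lra.
  have le_d := le_ginf (enorm_ge0 (q - v')).
  have d0 := enorm_ge0 (q - v').
  case: Fv' => [Fv'|gv'].
    by have := dist_to_le q Fv'; nra.
  pose w := vec3 (px v') (py v') 0; pose u := vec3 (Num.min (px w) 0) 0 0.
  have wE : w = eproj (perp z) v' by rewrite eproj_perp.
  have uE : u = eproj Finf w by rewrite eproj_Finf.
  have Fu : Finf u by split; rewrite !coordE// ge_min lexx orbT.
  have le_qw : enorm (q - w) <= enorm (q - v').
    by rewrite /w ler_enorm !dot3 !coordE qz; have := sqr_ge0 (pz v'); lra.
  have le_wv : enorm (w - v') <= enorm (q - v').
    rewrite /w ler_enorm !dot3 !coordE qz.
    by have := sqr_ge0 (px q - px v'); have := sqr_ge0 (py q - py v'); lra.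
  have le_D : dist_to Finf q <= enorm (q - w) + enorm (w - u).
    apply: le_trans (dist_to_le q Fu) _.
    by rewrite -[q - u](subrKA w) enormD.
  (* Half of the right side absorbs |q - w|, since [m >= 2] and [ginf] dominates the identity; the
     other half is left for |w - u|. *)
  suff : 2 * enorm (w - u) <= m * ginf (enorm (q - v')) by nra.
  have [->|neq] := eqVneq w u.
    rewrite subrr /enorm dot0r sqrtr0 mulr0.
    by rewrite mulr_ge0 ?ginf_ge0//; lra.
  have dwu : 0 < enorm (w - u) by apply: enorm_gt0 => /subr0_eq/eqP; exact/negP.
  have := mP (ginf (enorm (w - v')) / enorm (w - u)).
  rewrite mulrA ler_pdivlMr// => /(_ _)/le_trans; apply.
    apply: ereal_inf_lbound; exists v', w, u; split=> //; last exact/eqP.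
    split; last by case=> _ y0 _; case: gv'; rewrite y0 ltxx.
    by split; [exact: exp_graph_boundary|exact: le_trans bq].
  by rewrite ler_pM2l ?ginf_le ?enorm_ge0//; lra.
(* [ginf_galois] needs a positive bound. With one, it turns [approx] into a lower bound on every |q
   - v|, which the infimum inherits. *)
have [D0|D0] := leP (dist_to Finf q) 0.
  by apply: le_trans D0 _; rewrite mulr_ge0 ?ginf_ge0//; lra.
have m0 : 0 < m by lra.
rewrite -ler_pdivrMl// ginf_galois ?mulr_gt0 ?invr_gt0//.
apply: le_dist_to => [|v Kv]; first by exists 0.
by rewrite -ginf_galois ?mulr_gt0 ?invr_gt0 ?enorm_ge0// ler_pdivrMl// approx.
Qed.
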